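(* Let $X_1,X_2,\dots$ be independent identically distributed real random variables with $\mathbf E X_1=0$ and $\mathbf E X_1^2=\sigma^2\in(0,\infty)$. Let $S(n)=X_1+\dots+X_n$, $\tau_x=\inf\{n\ge1:\ x+S(n)\le0\}$ for $x\ge0$, and $$f(x):=-\mathbf E\left[x+S(\tau_x)\right],\quad x\ge0,$$ so that $V(x):=\mathbf E[-S(\tau_x)]=x+f(x)$. Then the function $f(x)$ is finite. Moreover, $$f(x)=o(x)\quad\text{as }x\to\infty .$$
   Context: Under the assumptions $\tau_x$ is almost surely finite and $x+S(\tau_x)\le0$, so $f(x)\in[0,\infty]$ is well defined a priori. *)

(* Defs.v *)
From HB Require Import structures.
From mathcomp Require Import all_boot all_order all_algebra.
From mathcomp Require Import finmap.
From mathcomp Require Import all_classical all_reals all_analysis.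

Set Implicit Arguments.
Unset Strict Implicit.
Unset Printing Implicit Defensive.

Import Order.TTheory GRing.Theory Num.Theory.
Import numFieldNormedType.Exports.

Local Open Scope classical_set_scope.
Local Open Scope ring_scope.

(* Lets Landau notations be used at +oo: the library declares [+oo_R] a filter
   but gives it no canonical [filter_on] structure. *)
Canonical pinfty_filter_type (R : numFieldType) :=
  FilterType (+oo_R) _.

Definition mutually_independent (d : measure_display) (T : measurableType d)
    (R : realType) (P : probability T R) (X : nat -> {RV P >-> R}) : Prop :=
  forall (J : {fset nat}) (B : nat -> set R),
    (forall i, measurable (B i)) ->
    P (\bigcap_(i in [set` J]) (X i @^-1` B i)) =
      (\prod_(i <- J) P (X i @^-1` B i))%E.

(* The laws are compared on Borel sets only: the value of [distribution] on a
   non-measurable set carries no information. *)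
Definition identically_distributed (d : measure_display)
    (T : measurableType d) (R : realType) (P : probability T R)
    (X : nat -> {RV P >-> R}) : Prop :=
  forall (i j : nat) (B : set R), measurable B ->
    distribution P (X i) B = distribution P (X j) B.

Section random_walk.
Context (d : measure_display) (T : measurableType d) (R : realType).
Context (P : probability T R) (X : nat -> {RV P >-> R}).

(* Steps are indexed from 0: [X i] is the step X_{i+1}. *)
Definition walk (n : nat) (w : T) : R := \sum_(i < n) X i w.

(* [None] is the value +oo of the infimum of the empty set. *)
Definition exit_time (x : R) (w : T) : option nat :=
  if pselect (exists n : nat, (0 < n)%N && (x + walk n w <= 0)) is left ex_n
  then Some (ex_minn ex_n) else None.

(* S(tau_x), set to 0 where tau_x = +oo; under the assumptions of the theorem
   this is a null event. *)
Definition walk_at_exit (x : R) (w : T) : R :=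
  if exit_time x w is Some n then walk n w else 0.

Definition overshoot (x : R) : \bar R :=
  (- 'E_P[fun w => (x + walk_at_exit x w)%R])%E.

Definition renewal (x : R) : \bar R :=
  'E_P[fun w => (- walk_at_exit x w)%R].

End random_walk.

(* Main.v *)
Require Import Defs.
From HB Require Import structures.
From mathcomp Require Import all_boot all_order all_algebra.
From mathcomp Require Import finmap.
From mathcomp Require Import all_classical all_reals all_analysis.
From mathcomp Require Import measurable_realfun ring lra.

(** The mean overshoot [f x] is dominated by a Lyapunov function that grows
like [A + eps * x], for every [eps > 0]; this gives finiteness and
[f x = o(x)] at the same time.

Suppose that [g >= 0], that [g y = - y] for [y < 0], and that
[E (g (y + X)) <= g y] for [y >= 0]. Then [g] of the walk stopped at its exit
time is a supermartingale, so by monotone convergence the mean overshoot from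
[x >= 0] is at most [g x] ([undershoot_le]). Everything thus reduces to
finding such a [g] below [A + eps * x] ([lyapunov_exists]).

On the half line take [g = A + U] with [U] concave and of slope at most [eps].
Compared with the linear continuation of [U], the function [g] changes at 0 in
two ways: it has a kink, which costs at most [2 * r y] in the drift at [y],
where [r y = E (- y - X)^+] is the mean overshoot of a single step, and it
drops by [A], which gains [A * P(X < - y)]. For [0 <= y <= M] the drop pays for
the kink as soon as [A] is large, because [r y] is there at most a constant
times [P(X < - y)] ([deficit_le_prob]). For [y >= M] the concavity of [U] has
to pay: since [X] has mean 0 and is not 0, there are [b > 0] and [p > 0] with
[P(X >= b) = p], and these upward steps gain at least
[- U'' (y + b) * b ^ 2 * p / 2]. So [- U'' (y + b)] has to be of the order of
[r y], but only beyond [M], and the slope that this costs is a multiple of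
[E ((b - X) ^ 2; X < - M)] ([concave_profile]). As the variance is finite, this
tends to 0 when [M] grows, so that the slope can be kept below [eps].

There remains to see that the walk almost surely exits ([never_exit_null]).
Adding a little more concavity makes the drift of [g] at most [- delta] for
[0 <= y <= L], hence the walk spends a finite expected time in the interval
[0 < y <= L] before its exit. On the other hand [V y = y + g y] dominates
[y^+] and is again a nonnegative supersolution, so the probability of being
above [L] is at most [V x / L] at all times. A walk that never exits is at each
time either in that interval or above [L]; averaging over a long time shows
that this has probability at most [V x / L], and [L] is arbitrary. *)

Import Order.TTheory GRing.Theory Num.Theory.
Import numFieldNormedType.Exports.

Local Open Scope classical_set_scope.
Local Open Scope ring_scope.

Set Implicit Arguments.
Unset Strict Implicit.

(** * A concave cubic and its one-step gain *)

Section hinge.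
Context {R : realFieldType}.
Implicit Types b c y z t : R.

Definition pospart (x : R) : R := Num.max x 0.

(** The concave function of slope [c ^ 2 / 2] on the negative half line whose
second derivative on the positive half line is [- (c - y)^+]. Integrating it over
[c] against a measure produces every curvature of the form
[y |-> E (c - y)^+], in particular the mean overshoot of a step. *)
Definition bend c y : R :=
  if 0 <= y then (c ^+ 3 - pospart (c - y) ^+ 3) / 6 else c ^+ 2 / 2 * y.

Lemma pospart_ge0 x : 0 <= pospart x.
Proof. by rewrite /pospart le_max lexx orbT. Qed.

Variant pospart_spec (x : R) : R -> Type :=
| Pospos of 0 <= x : pospart_spec x x
| Posneg of x < 0 : pospart_spec x 0.

Lemma pospartP x : pospart_spec x (pospart x).
Proof.
rewrite /pospart; case: (leP 0 x) => h.
- exact: Pospos.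
- exact: Posneg.
Qed.

(** Convexity of [t |-> (t^+) ^ 3]. *)
Lemma cube_tangent t z : pospart t ^+ 3 - 3 * pospart t ^+ 2 * z <= pospart (t - z) ^+ 3.
Proof.
case: (pospartP t) => t0; case: (pospartP (t - z)) => tz0; last by lra.
- have -> : z = t - (t - z) by lra.
  move: (t - z) tz0 => s s0.
  rewrite -subr_ge0 (_ : _ - _ = (s - t) ^+ 2 * (s + 2 * t)); last by ring.
  by rewrite mulr_ge0 ?sqr_ge0//; lra.
- rewrite [X in _ <= X](_ : _ = 0); last by ring.
  rewrite (_ : _ - _ = t ^+ 2 * (t - 3 * z)); last by ring.
  rewrite mulr_ge0_le0 ?sqr_ge0//; lra.
- by rewrite [X in X <= _](_ : _ = 0) ?exprn_ge0//; ring.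
Qed.

(** Quantitative convexity: over a step of length at least [b], the excess of the
cube over its tangent is at least the second derivative [6 * (t - b)^+] at distance
[b], times [b ^ 2 / 2]. *)
Lemma cube_tangent_gain b t z : 0 < b -> b <= z ->
  pospart t ^+ 3 - 3 * pospart t ^+ 2 * z + 3 * b ^+ 2 * pospart (t - b)
    <= pospart (t - z) ^+ 3.
Proof.
move=> b0 bz; case: (pospartP (t - b)) => tb; last first.
  by rewrite mulr0 addr0; exact: cube_tangent.
case: (pospartP t) => t0; last lra.
have z0 : 0 < z by lra.
case: (pospartP (t - z)) => tz0.
- rewrite -subr_ge0.
  rewrite (_ : _ - _ = 3 * (z ^+ 2 * (t - z) - b ^+ 2 * (t - b)) + 2 * z ^+ 3); last by ring.
  (* With z = b + u and t = z + v the difference has only nonnegative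
     coefficients in b, u, v. *)
  pose u := z - b; pose v := t - z.
  have u0 : 0 <= u by rewrite /u; lra.
  rewrite (_ : _ + _ = 6 * (b * u * v) + 3 * (u * u * v) + 2 * (b ^+ 3)
    + 3 * (b ^+ 2 * u) + 6 * (b * u * u) + 2 * u ^+ 3); last by rewrite /u /v; ring.
  by repeat apply: addr_ge0; rewrite ?mulr_ge0 ?exprn_ge0// ?ltW// /v; lra.
- rewrite expr0n/= -oppr_ge0.
  rewrite [X in 0 <= X](_ : _ = 3 * (t ^+ 2 * (z - t)) + (2 * t ^+ 3 - 3 * b ^+ 2 * (t - b)));
    last by ring.
  pose v := t - b.
  rewrite (_ : 2 * t ^+ 3 - 3 * b ^+ 2 * (t - b) =
    2 * b ^+ 3 + 3 * (b ^+ 2 * v) + 6 * (b * v * v) + 2 * v ^+ 3); last by rewrite /v; ring.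
  have v0 : 0 <= v by rewrite /v; lra.
  by repeat apply: addr_ge0; rewrite ?mulr_ge0 ?exprn_ge0// ?ltW//; lra.
Qed.

Lemma bend_le_lin c y : 0 <= c -> bend c y <= c ^+ 2 / 2 * y.
Proof.
move=> c0; rewrite /bend; case: ifPn => // y0.
have := cube_tangent c y; case: (pospartP c) => c1; last lra.
by lra.
Qed.

(** The one-step inequality behind the whole proof: the tangent line bound for the
concave function [bend c], improved on upward steps of size at least [b]. The gain
involves the curvature at [y + b], not at [y], since curvature decreases. *)
Lemma bend_step b c y z : 0 < b -> 0 <= c -> 0 <= y ->
  bend c (y + z) <= bend c y + pospart (c - y) ^+ 2 / 2 * z
    - b ^+ 2 / 2 * pospart (c - b - y) * (b <= z)%R%:R.
Proof.
move=> b0 c0 y0; rewrite {2}/bend y0.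
have H : pospart (c - y) ^+ 3 - 3 * pospart (c - y) ^+ 2 * z
  + 3 * b ^+ 2 * pospart (c - b - y) * (b <= z)%R%:R <= pospart (c - (y + z)) ^+ 3.
  rewrite opprD addrA; case: (leP b z) => bz; rewrite ?mulr1 ?mulr0 ?addr0.
  - by rewrite (addrAC c (- b)); apply: cube_tangent_gain.
  - exact: cube_tangent.
rewrite /bend; case: ifPn => yz; first by lra.
have -> : (b <= z) = false by apply/negbTE; rewrite -ltNge; lra.
rewrite mulr0 subr0.
have := cube_tangent (c - y) (- y); rewrite (_ : c - y - - y = c); last by ring.
have K : pospart (c - y) ^+ 2 <= c ^+ 2.
  rewrite ler_sqr ?nnegrE ?pospart_ge0//.
  by case: (pospartP (c - y)) => //; lra.
case: (pospartP c) => c1 ; last lra.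
move=> L.
have yz0 : y + z <= 0 by lra.
have M : pospart (c - y) ^+ 2 * (y + z) >= c ^+ 2 * (y + z).
  by rewrite -subr_ge0 -mulrBl mulr_le0// subr_le0.
by lra.
Qed.

Lemma bend_nondecreasing c y z : 0 <= c -> y <= z -> bend c y <= bend c z.
Proof.
move=> c0 yz; rewrite /bend.
case: ifPn => y0; case: ifPn => z0; last 2 first.
- have c3 : pospart (c - z) ^+ 3 <= c ^+ 3.
    by rewrite lerXn2r ?nnegrE ?pospart_ge0//; case: pospartP => //; lra.
  have : c ^+ 2 / 2 * y <= 0.
    by rewrite mulr_ge0_le0 ?divr_ge0 ?exprn_ge0//; lra.
  by lra.
- by rewrite ler_wpM2l// divr_ge0 ?exprn_ge0.
- have : pospart (c - z) ^+ 3 <= pospart (c - y) ^+ 3.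
    rewrite lerXn2r ?nnegrE ?pospart_ge0//.
    by case: (pospartP (c - z)); case: (pospartP (c - y)); lra.
  by lra.
- lra.
Qed.

Lemma bend_ge0 c y : 0 <= c -> 0 <= y -> 0 <= bend c y.
Proof.
move=> c0 y0; apply: le_trans (bend_nondecreasing c0 y0).
by rewrite /bend lexx subr0; case: pospartP => // c1; rewrite ?subrr ?mul0r// ; lra.
Qed.

End hinge.

(** * Moments of a single step *)

Section one_step.
Context d (T : measurableType d) (R : realType).
Context (P : probability T R) (X : {RV P >-> R}).

Local Notation "'E[ f ]" := (Rintegral P setT f) (at level 5, f at level 99).
Local Notation Pint f := (P.-integrable setT (EFin \o f)).

Lemma measurable_bool_nat (p : T -> bool) :
  measurable [set w | p w] -> measurable_fun setT (fun w => (p w)%:R : R).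
Proof.
move=> mp; rewrite (_ : (fun w => _) = \1_[set w | p w]); last first.
  by apply/funext => w; rewrite indicE mem_setE.
exact: measurable_indic.
Qed.

Lemma Rintegral_bool (p : T -> bool) : measurable [set w | p w] ->
  'E[fun w => (p w)%:R] = fine (P [set w | p w]).
Proof.
move=> mp; rewrite /Rintegral; congr fine.
rewrite -[in RHS](setIT [set w | p w]) -integral_indic//.
by apply: eq_integral => w _; rewrite indicE mem_setE.
Qed.

Lemma measurable_preim (B : set R) : measurable B -> measurable (X @^-1` B).
Proof. by move=> mB; rewrite -[_ @^-1` _]setTI; exact: measurable_funP. Qed.

Lemma measurable_lt_set (a : R) : measurable [set w | X w < a].
Proof.
rewrite (_ : [set w | _] = X @^-1` `]-oo, a[%classic).
  exact: measurable_preim.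
by apply/seteqP; split=> w /=; rewrite in_itv.
Qed.

Lemma measurable_ge_set (a : R) : measurable [set w | a <= X w].
Proof.
rewrite (_ : [set w | _] = X @^-1` `[a, +oo[%classic).
  exact: measurable_preim.
by apply/seteqP; split=> w /=; rewrite in_itv/= andbT.
Qed.

Lemma measurable_fun_pospart d' (T' : measurableType d') (f : T' -> R) :
  measurable_fun setT f -> measurable_fun setT (fun w => pospart (f w)).
Proof. by move=> mf; apply: measurable_maxr. Qed.

Lemma integrable_add (f g : T -> R) : Pint f -> Pint g -> Pint (fun w => f w + g w).
Proof.
move=> fi gi; rewrite (_ : _ \o _ = (EFin \o f) \+ (EFin \o g))%E//.
exact: (integrableD measurableT).
Qed.

Lemma integrable_sub (f g : T -> R) : Pint f -> Pint g -> Pint (fun w => f w - g w).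
Proof.
move=> fi gi; rewrite (_ : _ \o _ = (EFin \o f) \- (EFin \o g))%E//.
exact: (integrableB measurableT).
Qed.

Lemma integrable_scale (a : R) (f : T -> R) : Pint f -> Pint (fun w => a * f w).
Proof. exact: (integrableZl measurableT). Qed.

Lemma integrable_cst (a : R) : Pint (fun=> a).
Proof. exact: finite_measure_integrable_cst. Qed.

Lemma Rintegral_prob_cst (a : R) : 'E[fun=> a] = a.
Proof. by rewrite /Rintegral integral_cst//= probability_setT mule1. Qed.

Hypothesis sqint : Pint (fun w => X w ^+ 2).

(** All integrability statements about one step follow from this criterion. *)
Lemma integrable_le_quad (a : R) (f : T -> R) : measurable_fun setT f ->
  (forall w, `|f w| <= a * (1 + X w ^+ 2)) -> Pint f.
Proof.
move=> mf fa.
apply: (@le_integrable _ _ _ P setT _ _ (EFin \o (fun w => a * (1 + X w ^+ 2)))) => //.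
- exact/measurable_EFinP.
- by move=> w _ /=; rewrite lee_fin (le_trans (fa w))// ler_norm.
- rewrite (_ : EFin \o _ = fun w => (a%:E * (1%:E + (X w ^+ 2)%:E))%E); last first.
    by apply/funext => w /=; rewrite -EFinD -EFinM.
  apply: (integrableZl measurableT); apply: (integrableD measurableT) => //.
  exact: finite_measure_integrable_cst.
Qed.

Lemma integrable_bool (p : T -> bool) : measurable [set w | p w] ->
  Pint (fun w => (p w)%:R).
Proof.
move=> mp; apply: (@integrable_le_quad 1); first exact: measurable_bool_nat.
move=> w; rewrite mul1r; have := sqr_ge0 (X w).
by case: (p w); rewrite /= ?normr1 ?normr0; lra.
Qed.

Lemma abs_le_quad (x : R) : `|x| <= 1 + x ^+ 2.
Proof. by rewrite -(real_normK (num_real x)); nra. Qed.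

Lemma integrable_step : Pint X.
Proof. by apply: (@integrable_le_quad 1) => // w; rewrite mul1r abs_le_quad. Qed.

Lemma deficit_bounds (y : R) w : 0 <= y -> 0 <= pospart (- y - X w) <= 1 + X w ^+ 2.
Proof.
move=> y0; rewrite pospart_ge0/=; have := abs_le_quad (X w).
have := sqr_ge0 (X w); case: pospartP => //; last by lra.
by move=> _ _; rewrite ler_norml; lra.
Qed.

Lemma integrable_deficit y : 0 <= y -> Pint (fun w => pospart (- y - X w)).
Proof.
move=> y0; apply: (@integrable_le_quad 1).
  by apply: measurable_fun_pospart; apply: measurable_funB.
by move=> w; rewrite mul1r ger0_norm ?pospart_ge0//; case/andP: (deficit_bounds w y0).
Qed.

(** The mean overshoot of one step is controlled by the probability of an
overshoot, uniformly over a bounded interval of starting points. If [X] can go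
below [- M] this holds because [P(X < - y)] is bounded below for [0 <= y <= M];
otherwise the overshoot itself is at most [M]. *)
Lemma deficit_le_prob M : 0 <= M -> exists2 A : R, 0 <= A &
  forall y : R, 0 <= y <= M ->
   'E[fun w => pospart (- y - X w)] <= A * fine (P [set w | X w < - y]).
Proof.
move=> M0; have mlt := measurable_lt_set.
have [PM|PM] := leP (P [set w | X w < - M]) 0%E.
- exists M => // y /andP[y0 yM].
  have PM0 : P [set w | X w < - M] = 0%E by apply/eqP; rewrite eq_le PM measure_ge0.
  rewrite -Rintegral_bool// -RintegralZl//; last exact: integrable_bool.
  rewrite /Rintegral; apply: fine_le.
  - exact/integrable_fin_num/integrable_deficit.
  - apply/integrable_fin_num => //; apply: (@integrable_le_quad M).
      by apply: measurable_funM => //; exact: measurable_bool_nat.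
    move=> w; rewrite normrM ger0_norm// ler_wpM2l//.
    by have := sqr_ge0 (X w); case: (X w < _); rewrite /= ?normr1 ?normr0; lra.
  apply: ae_ge0_le_integral => //.
  - by move=> w _; rewrite lee_fin pospart_ge0.
  - apply/measurable_EFinP.
    by apply: measurable_fun_pospart; apply: measurable_funB.
  - by move=> w _; rewrite lee_fin mulr_ge0.
  - apply/measurable_EFinP.
    by apply: measurable_funM => //; exact: measurable_bool_nat.
  exists [set w | X w < - M]; split => // w /= h; apply: contrapT => /negP.
  rewrite -leNgt => MX; apply: h => _; rewrite lee_fin.
  by case: pospartP => h; case: ltP => h' /=; lra.
- have PMfin : (P [set w | X w < - M] \is a fin_num) by exact: fin_num_measure.
  have p0 : 0 < fine (P [set w | X w < - M]).
    by rewrite -lte_fin fineK.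
  exists ('E[fun w => pospart (- 0 - X w)] / fine (P [set w | X w < - M])).
    by apply: divr_ge0; [apply: Rintegral_ge0 => w _; exact: pospart_ge0|exact: ltW].
  move=> y /andP[y0 yM].
  rewrite mulrAC -mulrA mulrC.
  apply: (@le_trans _ _ 'E[fun w => pospart (- 0 - X w)]).
    apply: le_Rintegral => //; [exact: integrable_deficit..|].
    by move=> w _; case: pospartP => h; case: pospartP => h'; lra.
  rewrite ler_peMl//.
    by rewrite Rintegral_ge0// => w _; rewrite pospart_ge0.
  rewrite ler_pdivlMr// mul1r fine_le ?fin_num_measure// le_measure ?inE// => w /=; lra.
Qed.

(** The slope spent on the curvature beyond [M] can be made as small as desired;
finiteness of the variance enters here. *)
Lemma tail_second_moment (b eta : R) : 0 < eta -> exists2 M : R, 0 <= M &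
  'E[fun w => (b - X w) ^+ 2 * (X w < - M)%R%:R] <= eta.
Proof.
move=> eta0.
pose f n w := ((b - X w) ^+ 2 * (X w < - n%:R)%R%:R : R).
have mf n : measurable_fun setT (f n).
  apply: measurable_funM; last exact/measurable_bool_nat/measurable_lt_set.
  by apply: measurable_funX; apply: measurable_funB.
have mb : measurable_fun setT (fun w => (b - X w) ^+ 2).
  by apply: measurable_funX; apply: measurable_funB.
have intb : Pint (fun w => (b - X w) ^+ 2).
  apply: (@integrable_le_quad (2 * (1 + b ^+ 2))) => // w; rewrite ger0_norm ?sqr_ge0//.
  by have := sqr_ge0 (X w); have := sqr_ge0 b; have := sqr_ge0 (b + X w); nra.
have [] := @dominated_convergence _ _ _ P setT measurableT (fun n => EFin \o f n)
  (cst 0%E) (EFin \o (fun w => (b - X w) ^+ 2)).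
- by move=> n; exact/measurable_EFinP.
- exact: measurable_cst.
- apply: aeW => w _; apply: cvg_near_cst.
  exists (Num.truncn `|X w|).+1 => // n /= hn; rewrite /f.
  case: ltP; rewrite ?mulr0// => Xn; exfalso.
  have : `|X w| < (Num.truncn `|X w|).+1%:R by apply: truncnS_gt.
  have : (Num.truncn `|X w|).+1%:R <= n%:R :> R by rewrite ler_nat.
  have := ler_norm (- X w); rewrite normrN; lra.
- exact: intb.
- apply: aeW => w n _ /=; rewrite lee_fin /f normrM ger0_norm ?sqr_ge0//.
  by case: ltP; rewrite /= ?normr1 ?normr0 ?mulr1// mulr0 sqr_ge0.
- move=> _ _; rewrite integral_cst// mul0e => /fine_cvgP[_ cv].
have : \forall n \near \oo, 'E[f n] < eta.
  exact: (cvgr_lt 0 cv).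
case=> n _ /(_ n (leqnn n)) H.
by exists n%:R => //; exact: ltW.
Qed.

(** A centred step that is not almost surely [0] takes positive values: otherwise
[X <= 0] almost surely and [E X = 0] force [X = 0] almost surely. *)
Lemma exists_upward_step : 'E[X] = 0 -> 0 < 'E[fun w => X w ^+ 2] ->
  exists2 b : R, 0 < b & 0 < fine (P [set w | b <= X w]).
Proof.
move=> EX VX; apply: contrapT => H.
have N n : P [set w | n.+1%:R^-1 <= X w] = 0%E.
  apply/eqP; rewrite eq_le measure_ge0 andbT leNgt; apply/negP => h.
  apply: H; exists (n.+1%:R^-1); rewrite ?invr_gt0//.
  by rewrite -lte_fin fineK// fin_num_measure//; exact: measurable_ge_set.
have Xle0 : {ae P, forall w, X w <= 0}.
  have [B [mB PB0 subB]] : P.-negligible (\bigcup_n [set w | n.+1%:R^-1 <= X w]).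
    apply: negligible_bigcup => n; exists [set w | n.+1%:R^-1 <= X w].
    by split; [exact: measurable_ge_set|exact: N|].
  exists B; split => // w /= /negP; rewrite -ltNge => Xw0; apply: subB.
  exists (Num.truncn (X w)^-1) => //=.
  rewrite invf_ple ?posrE//.
  exact/ltW/truncnS_gt.
have X0 : {ae P, forall w, setT w -> ((X w)%:E = 0)%E}.
  have EN : (\int[P]_w `| (- X w)%:E |)%E = 0%E.
    transitivity (\int[P]_w (- X w)%:E)%E.
      apply: ae_eq_integral => //.
      - apply/measurable_EFinP/measurableT_comp => //.
        exact: measurable_funN.
      - apply/measurable_EFinP; exact: measurable_funN.
      by apply: filterS Xle0 => w Xw _ /=; rewrite ger0_norm// oppr_ge0.
    have iN : P.-integrable setT (fun w => (- X w)%:E).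
      apply: (@integrable_le_quad 1 (fun w => - X w)); first exact: measurable_funN.
      by move=> w; rewrite mul1r normrN abs_le_quad.
    rewrite -(fineK (integrable_fin_num _ iN))//; congr EFin.
    transitivity ('E[fun w => (-1) * X w]).
      by apply: eq_Rintegral => w _; rewrite mulN1r.
    by rewrite RintegralZl// ?EX ?mulr0//; exact: integrable_step.
  have mN : measurable_fun setT (fun w => (- X w)%:E).
    apply/measurable_EFinP; exact: measurable_funN.
  have := (ae_eq_integral_abs P measurableT mN).1 EN.
  by apply: filterS => w /= /(_ I)/eqP; rewrite eqe oppr_eq0 => /eqP ->.
move: VX; rewrite /Rintegral (ae_eq_integral (cst 0%E))//.
- by rewrite integral_cst// mul0e ltxx.
- exact/measurable_EFinP/measurable_funX.
- by apply: filterS X0 => w /(_ I) [] -> _ /=; rewrite expr0n.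
Qed.

End one_step.

(** * Concave profiles with prescribed curvature *)

Section curvature.
Context d (T : measurableType d) (R : realType).
Context (P : probability T R) (X : {RV P >-> R}).

Local Notation "'E[ f ]" := (Rintegral P setT f) (at level 5, f at level 99).
Local Notation Pint f := (P.-integrable setT (EFin \o f)).

Hypothesis sqint : Pint (fun w => X w ^+ 2).

Section tail_profile.
Variables (b M : R).
Hypotheses (b0 : 0 < b) (M0 : 0 <= M).

Let c w := b - X w.
Let far w : R := (X w < - M)%R%:R.

(** Averages of [bend c] over [c = b - X] on the event [X < - M], of its slope, and
of its curvature at [y + b]. The shift by [b] is chosen so that the latter is
exactly the mean overshoot restricted to the event. *)
Definition tail_bend y : R := 'E[fun w => bend (c w) y * far w].
Definition tail_slope y : R := 'E[fun w => pospart (c w - y) ^+ 2 / 2 * far w].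
Definition tail_deficit y : R := 'E[fun w => pospart (- y - X w) * far w].
Definition tail_moment : R := 'E[fun w => c w ^+ 2 * far w].

Let mc : measurable_fun setT c. Proof. exact: measurable_funB. Qed.

Let mfar : measurable_fun setT far.
Proof. exact/measurable_bool_nat/measurable_lt_set. Qed.

Let c_ge0 w : X w < - M -> 0 <= c w.
Proof.
move=> h; rewrite subr_ge0 (le_trans (ltW h))// (le_trans _ (ltW b0))//.
by rewrite oppr_le0.
Qed.

Let far_integrable (a : R) (f : T -> R) : 0 <= a -> measurable_fun setT f ->
  (forall w, 0 <= c w -> `|f w| <= a * c w ^+ 2) -> Pint (fun w => f w * far w).
Proof.
move=> a0 mf fa; apply: (@integrable_le_quad _ _ _ _ _ sqint (2 * (1 + b ^+ 2) * a)).
  exact: measurable_funM.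
move=> w; have B : c w ^+ 2 <= 2 * (1 + b ^+ 2) * (1 + X w ^+ 2).
  by rewrite /c; have := sqr_ge0 (X w); have := sqr_ge0 b; have := sqr_ge0 (b + X w); nra.
rewrite /far; case: ltP => h; last first.
  by rewrite mulr0 normr0 !mulr_ge0// ?addr_ge0 ?sqr_ge0.
rewrite mulr1; apply: (le_trans (fa _ (c_ge0 h))).
by rewrite (mulrC _ a) -mulrA ler_wpM2l.
Qed.

Let far_le (f g : T -> R) : Pint (fun w => f w * far w) -> Pint (fun w => g w * far w) ->
  (forall w, 0 <= c w -> X w < - M -> f w <= g w) ->
  'E[fun w => f w * far w] <= 'E[fun w => g w * far w].
Proof.
move=> fi gi fg; apply: le_Rintegral => // w _; rewrite /far.
by case: ltP => h; rewrite ?mulr0// !mulr1 fg// c_ge0.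
Qed.

Let int_bend y : Pint (fun w => bend (c w) y * far w).
Proof.
apply: (@far_integrable (`|y| / 2)); first by rewrite divr_ge0.
  rewrite /bend; case: (0 <= y); apply: measurable_funM => //.
  - by apply: measurable_funB; apply: measurable_funX => //;
      apply: measurable_fun_pospart; exact: measurable_funB.
  - by apply: measurable_funM => //; exact: measurable_funX.
move=> w c0; have [y0|y0] := leP 0 y.
  by rewrite !ger0_norm ?bend_ge0//; have := bend_le_lin y c0; lra.
by rewrite /bend (lt_geF y0) normrM ger0_norm ?divr_ge0 ?sqr_ge0//
  le_eqVlt; apply/orP; left; apply/eqP; ring.
Qed.

Let int_slope y : 0 <= y -> Pint (fun w => pospart (c w - y) ^+ 2 / 2 * far w).
Proof.
move=> y0; apply: (@far_integrable 2^-1); first by rewrite invr_ge0.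
  apply: measurable_funM => //; apply: measurable_funX.
  by apply: measurable_fun_pospart; exact: measurable_funB.
move=> w c0; rewrite ger0_norm ?divr_ge0 ?sqr_ge0//.
by have := sqr_ge0 (c w); case: pospartP => h; nra.
Qed.

Let int_tail_deficit y : 0 <= y -> Pint (fun w => pospart (- y - X w) * far w).
Proof.
move=> y0; apply: (@integrable_le_quad _ _ _ _ _ sqint 1).
  by apply: measurable_funM => //; apply: measurable_fun_pospart; exact: measurable_funB.
move=> w; rewrite mul1r; have /andP[h1 h2] := deficit_bounds X w y0.
rewrite normrM ger0_norm// /far; case: ltP => _ /=.
  by rewrite normr1 mulr1.
by rewrite normr0 mulr0 addr_ge0// sqr_ge0.
Qed.

Lemma tail_bend_step y z : 0 <= y ->
  tail_bend (y + z) <= tail_bend y + tail_slope y * z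
    - b ^+ 2 / 2 * tail_deficit y * (b <= z)%R%:R.
Proof.
move=> y0.
have ib := int_bend; have iS := int_slope y0; have iD := int_tail_deficit y0.
pose A w := bend (c w) y * far w.
pose B w := z * (pospart (c w - y) ^+ 2 / 2 * far w).
pose C w := b ^+ 2 / 2 * (b <= z)%R%:R * (pospart (- y - X w) * far w).
have iB : Pint B by exact: integrable_scale.
have iC : Pint C by exact: integrable_scale.
have iAB : Pint (fun w => A w + B w) by exact: integrable_add (ib y) iB.
have -> : tail_bend y + tail_slope y * z - b ^+ 2 / 2 * tail_deficit y * (b <= z)%R%:R
    = 'E[fun w => A w + B w - C w].
  rewrite RintegralB// RintegralD//; last exact: ib.
  by rewrite 2?RintegralZl// /tail_bend /tail_slope /tail_deficit; ring.
have E w : A w + B w - C w = (bend (c w) y + pospart (c w - y) ^+ 2 / 2 * z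
    - b ^+ 2 / 2 * pospart (- y - X w) * (b <= z)%R%:R) * far w.
  by rewrite /A /B /C; ring.
have -> : 'E[fun w => A w + B w - C w] = 'E[fun w => (bend (c w) y + pospart (c w - y) ^+ 2 / 2 * z
    - b ^+ 2 / 2 * pospart (- y - X w) * (b <= z)%R%:R) * far w].
  by apply: eq_Rintegral => w _; exact: E.
apply: far_le; first exact: ib.
  rewrite (_ : _ \o _ = EFin \o (fun w => A w + B w - C w)); first exact: integrable_sub.
  by apply/funext => w /=; rewrite E.
move=> w cw _; have := bend_step z b0 cw y0.
by rewrite (_ : c w - b - y = - y - X w)// /c; ring.
Qed.

Lemma tail_bend_nondecreasing y z : y <= z -> tail_bend y <= tail_bend z.
Proof.
by move=> yz; apply: far_le; [exact: int_bend..|] => w cw _; exact: bend_nondecreasing.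
Qed.

Lemma tail_bend_neg y : y < 0 -> tail_bend y = tail_moment / 2 * y.
Proof.
move=> y0; rewrite /tail_moment -mulrA mulrC -RintegralZl//; last first.
  apply: (@far_integrable 1) => //; first exact: measurable_funX.
  by move=> w _; rewrite ger0_norm ?sqr_ge0// mul1r.
by apply: eq_Rintegral => w _; rewrite /bend leNgt y0/=; ring.
Qed.

Lemma tail_moment_ge0 : 0 <= tail_moment.
Proof. by apply: Rintegral_ge0 => w _; rewrite mulr_ge0 ?sqr_ge0. Qed.

Lemma tail_bend_ge0 y : 0 <= y -> 0 <= tail_bend y.
Proof.
move=> y0; apply: Rintegral_ge0 => w _; rewrite /far; case: ltP => h; rewrite ?mulr0//.
by rewrite mulr1 bend_ge0// c_ge0.
Qed.

Lemma tail_bend_le y : 0 <= y -> tail_bend y <= tail_moment / 2 * y.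
Proof.
move=> y0; have im : Pint (fun w => c w ^+ 2 * far w).
  apply: (@far_integrable 1) => //; first exact: measurable_funX.
  by move=> w _; rewrite ger0_norm ?sqr_ge0// mul1r.
have -> : tail_moment / 2 * y = 'E[fun w => (c w ^+ 2 / 2 * y) * far w].
  rewrite /tail_moment -mulrA mulrC -RintegralZl//.
  by apply: eq_Rintegral => w _; ring.
apply: far_le.
- exact: int_bend.
- rewrite (_ : _ \o _ = EFin \o (fun w => (2^-1 * y) * (c w ^+ 2 * far w))); last first.
    by apply/funext => w /=; congr EFin; ring.
  exact: integrable_scale.
- by move=> w cw _; exact: bend_le_lin.
Qed.

(** From [y >= M] only steps below [- M] can overshoot, so the curvature that is
provided matches the mean overshoot of a step. *)
Lemma tail_deficitE y : M <= y -> tail_deficit y = 'E[fun w => pospart (- y - X w)].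
Proof.
move=> My; apply: eq_Rintegral => w _; rewrite /far.
by case: ltP => h; rewrite ?mulr1// mulr0; case: pospartP => //; lra.
Qed.

Lemma tail_deficit_ge0 y : 0 <= tail_deficit y.
Proof. by apply: Rintegral_ge0 => w _; rewrite mulr_ge0// pospart_ge0. Qed.

End tail_profile.
End curvature.

(** * The Lyapunov function *)

Section lyapunov.
Context d (T : measurableType d) (R : realType).
Context (P : probability T R) (X : {RV P >-> R}).

Local Notation "'E[ f ]" := (Rintegral P setT f) (at level 5, f at level 99).
Local Notation Pint f := (P.-integrable setT (EFin \o f)).

(** Supersolutions with drift at most [- k]. The additive form avoids a difference
of integrals that might be infinite. *)
Definition drift_below (g k : R -> R) := forall y : R, 0 <= y ->
  (\int[P]_w (g (y + X w))%:E + (k y)%:E <= (g y)%:E)%E.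

Hypothesis sqint : Pint (fun w => X w ^+ 2).
Hypothesis EX : 'E[X] = 0.
Hypothesis VX : 0 < 'E[fun w => X w ^+ 2].

(** The concave part of the Lyapunov function. Here [D] is its slope and
[rho y] its gain on upward steps, which happen with probability [p]. *)
Lemma concave_profile (eps L b p : R) : 0 < eps -> 0 <= L -> 0 < b -> 0 < p ->
  exists (U D rho : R -> R) (s delta M : R),
  [/\ 0 < delta /\ 0 <= M,
      0 <= s <= eps,
      {homo U : y z / y <= z},
      forall y : R, (y < 0 -> U y = s * y) /\ (0 <= y -> 0 <= U y <= s * y) &
      forall y : R, 0 <= y ->
        (forall z, U (y + z) <= U y + D y * z - rho y * (b <= z)%R%:R) /\
        (M <= y)%R%:R * (2 * 'E[fun w => pospart (- y - X w)])
          + delta * (y <= L)%R%:R <= rho y * p].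
Proof.
move=> eps0 L0 b0 p0.
have bb0 : 0 < b ^+ 2 by rewrite exprn_gt0.
(* C is such that C * b ^ 2 / 2 * p = 2, the factor in front of the mean
   overshoot; half of the slope eps goes to the tail term, and the other half to
   the single bend at c = L + 1 + b, which is strictly curved on [0, L]. *)
pose C := 4 / (b ^+ 2 * p); have C0 : 0 < C by rewrite divr_gt0 ?mulr_gt0.
have [M M0 hM] : exists2 M : R, 0 <= M & tail_moment X b M <= eps / C.
  by apply: (tail_second_moment sqint); rewrite divr_gt0.
pose c := L + 1 + b; have c0 : 0 < c by rewrite /c; lra.
pose k := eps / c ^+ 2; have k0 : 0 < k by rewrite divr_gt0 ?exprn_gt0.
pose m := tail_moment X b M; have m0 : 0 <= m by exact: tail_moment_ge0.
have Cm : C * m <= eps by rewrite mulrC -ler_pdivlMr.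
have kc : k * c ^+ 2 = eps by rewrite /k divfK// gt_eqF// exprn_gt0.
have CbP : C * (b ^+ 2 * p) = 4 by rewrite /C divfK// gt_eqF// mulr_gt0.
have dpk : 0 < b ^+ 2 / 2 * p * k.
  by apply: mulr_gt0 => //; apply: mulr_gt0 => //; exact: divr_gt0.
have C0' := ltW C0; have k0' := ltW k0.
exists (fun y => C * tail_bend X b M y + k * bend c y).
exists (fun y => C * tail_slope X b M y + k * (pospart (c - y) ^+ 2 / 2)).
exists (fun y => b ^+ 2 / 2 * (C * tail_deficit X M y + k * pospart (L + 1 - y))).
exists ((C * m + eps) / 2), (b ^+ 2 / 2 * p * k), M.
split.
- by [].
- have : 0 <= C * m by rewrite mulr_ge0// ltW.
  by move=> ?; apply/andP; split; lra.
- move=> y z yz; rewrite lerD// ler_wpM2l//.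
  + exact: tail_bend_nondecreasing.
  + by apply: bend_nondecreasing => //; exact: ltW.
- move=> y; split=> y0.
  + by rewrite tail_bend_neg// -/m /bend (lt_geF y0) -kc; ring.
  + have h1 := tail_bend_ge0 X b0 M0 y0; have h2 := tail_bend_le sqint b0 M0 y0.
    have h3 := bend_ge0 (ltW c0) y0; have h4 := bend_le_lin y (ltW c0).
    apply/andP; split; first by rewrite addr_ge0// mulr_ge0.
    rewrite (_ : (C * m + eps) / 2 * y = C * (m / 2 * y) + k * (c ^+ 2 / 2 * y)).
      by rewrite lerD// ler_wpM2l.
    by rewrite -kc; ring.
- move=> y y0; split.
  + move=> z; have h1 := tail_bend_step sqint b0 M0 z y0.
    have h2 := bend_step z b0 (ltW c0) y0.
    rewrite (_ : c - b - y = L + 1 - y) in h2; last by rewrite /c; ring.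
    have {}h1 := ler_wpM2l (ltW C0) h1; have {}h2 := ler_wpM2l (ltW k0) h2.
    by lra.
  + rewrite (_ : b ^+ 2 / 2 * _ * p = 2 * tail_deficit X M y
      + b ^+ 2 / 2 * p * k * pospart (L + 1 - y)); last first.
      transitivity (C * (b ^+ 2 * p) / 2 * tail_deficit X M y
        + b ^+ 2 / 2 * p * k * pospart (L + 1 - y)).
        by ring.
      by rewrite CbP; field.
    apply: lerD.
      have [My|My] := leP M y; first by rewrite mul1r tail_deficitE.
      by rewrite mul0r mulr_ge0// tail_deficit_ge0.
    rewrite ler_wpM2l//; first by rewrite ltW.
    by have [h|h] := leP y L; case: pospartP => //=; lra.
Qed.

(** The Lyapunov function: [A + U] on the half line and [- y] below it. The kink at
[0] is paid for by the concavity of [U] beyond [M] and by the drop [A] before. *)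
Lemma lyapunov_exists (eps L : R) : 0 < eps <= 1 -> 0 <= L ->
  exists (g : R -> R) (A delta : R),
  [/\ 0 < delta /\ 0 <= A, measurable_fun setT g,
      (forall y : R, 0 <= g y) /\ (forall y : R, y < 0 -> g y = - y),
      forall y : R, 0 <= y -> g y <= A + eps * y &
      drift_below g (fun y => delta * (y <= L)%R%:R)].
Proof.
move=> /andP[eps0 eps1] L0.
have [b b0 p0] := exists_upward_step sqint EX VX.
set p := fine _ in p0.
have [U [D [rho [s [delta [M [[delta0 M0] /andP[s0 seps] Umono Ulin Ustep]]]]]]] :=
  concave_profile eps0 L0 b0 p0.
have [A0 A00 hA] := deficit_le_prob sqint M0.
pose A := 2 * A0; have A_ge0 : 0 <= A by rewrite mulr_ge0.
pose g (y : R) := if 0 <= y then A + U y else - y.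
have mU : measurable_fun setT U by exact: nondecreasing_measurable.
have mg : measurable_fun setT g.
  apply: measurable_fun_ifT.
  - exact: measurable_fun_ler.
  - exact: measurable_funD.
  - exact: measurable_funN.
have g0 (y : R) : 0 <= g y.
  rewrite /g; case: ifPn => y0; last by lra.
  by have [_ /(_ y0)/andP[? _]] := Ulin y; lra.
have gneg (y : R) : y < 0 -> g y = - y by rewrite /g => y0; rewrite (lt_geF y0).
have glin (y : R) : 0 <= y -> g y <= A + eps * y.
  move=> y0; rewrite /g y0; have [_ /(_ y0)/andP[_ h]] := Ulin y.
  by rewrite lerD2l (le_trans h)// ler_wpM2r.
exists g, A, delta; split => // y y0.
have [Uyz Urho] := Ustep y y0.
have mlt := measurable_lt_set X (- y); have mge := measurable_ge_set X b.
(* The bound h w on g (y + X w): the tangent of U, plus the kink, minus the gain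
   on upward steps and minus the drop; U has slope s <= 1 below 0, so the kink
   is at most 2 * (- y - X w)^+. *)
pose h w := (A + U y + D y * X w + 2 * pospart (- y - X w)) -
  (rho y * (b <= X w)%R%:R + A * (X w < - y)%R%:R).
have gh w : g (y + X w) <= h w.
  have hs := Uyz (X w); rewrite /g /h.
  have [yz|yz] := leP 0 (y + X w).
    rewrite (_ : X w < - y = false) ?mulr0; last by apply/negbTE; rewrite -leNgt; lra.
    by have := pospart_ge0 (- y - X w); lra.
  rewrite (_ : X w < - y); last by lra.
  case: pospartP => h'; last by lra.
  rewrite (Ulin _).1 // in hs.
  have : (y + X w) * (1 - s) <= 0 by apply: mulr_le0_ge0; lra.
  rewrite mulr1; lra.
have iX := integrable_step sqint; have iD := integrable_deficit sqint y0.
have i1 : Pint (fun w => D y * X w) by exact: integrable_scale.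
have i2 : Pint (fun w => 2 * pospart (- y - X w)) by exact: integrable_scale.
have i0 := integrable_cst P (A + U y).
have ib := integrable_bool sqint mge; have il := integrable_bool sqint mlt.
have i3 : Pint (fun w => rho y * (b <= X w)%R%:R) by exact: integrable_scale.
have i4 : Pint (fun w => A * (X w < - y)%R%:R) by exact: integrable_scale.
have i5 := integrable_add i3 i4.
have i6 := integrable_add i0 i1.
have i7 := integrable_add i6 i2.
have ih : Pint h by exact: integrable_sub i7 i5.
have Eh : 'E[h] = A + U y + 2 * 'E[fun w => pospart (- y - X w)]
   - (rho y * p + A * fine (P [set w | X w < - y])).
  rewrite /h RintegralB// RintegralD// RintegralD// [X in _ - X]RintegralD//.
  rewrite !RintegralZl// EX mulr0 addr0 Rintegral_prob_cst.
  by rewrite !Rintegral_bool.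
have -> : (g y)%:E = ((g y - delta * (y <= L)%R%:R)%:E + (delta * (y <= L)%R%:R)%:E)%E.
  by rewrite -EFinD subrK.
rewrite leeD2rE//.
apply: (@le_trans _ _ (\int[P]_w (h w)%:E)%E).
  apply: ge0_le_integral => //.
  - by move=> w _; rewrite lee_fin.
  - by apply/measurable_EFinP/measurableT_comp => //; exact: measurable_funD.
  - exact: measurable_int ih.
  - by move=> w _; rewrite lee_fin.
rewrite -(fineK (integrable_fin_num measurableT ih)) lee_fin.
change ('E[h] <= g y - delta * (y <= L)%R%:R).
rewrite Eh /g y0.
have prob0 : 0 <= fine (P [set w | X w < - y]) by rewrite fine_ge0.
have Aprob := mulr_ge0 A_ge0 prob0.
case: (leP M y) Urho => My Urho; rewrite /= ?mul1r ?mul0r in Urho; first lra.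
have := hA y; rewrite y0 (ltW My) => /(_ isT).
rewrite /A; lra.
Qed.

End lyapunov.

(** * The walk frozen at its exit *)

(** Independence of a random variable from an event needs checking on a generating
pi-system only: both sides are finite measures in [S]. *)
Lemma indep_of_generator d d' (T : measurableType d) (T' : measurableType d')
    (R : realType) (P : probability T R) (Z : {RV P >-> T'}) (E : set T)
    (G : set (set T')) :
  measurable E -> measurable = <<s G >> -> setI_closed G -> G setT ->
  (forall S, G S -> P (Z @^-1` S `&` E) = (P (Z @^-1` S) * P E)%E) ->
  forall S, measurable S -> P (Z @^-1` S `&` E) = (P (Z @^-1` S) * P E)%E.
Proof.
move=> mE mG GI GT GE S mS.
have PE0 : 0 <= fine (P E) by rewrite fine_ge0.
pose m1 := [the {measure set T' -> \bar R} of pushforward (mrestr P mE) Z].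
have mZ : measurable_fun setT Z by [].
pose m2 := mscale (NngNum PE0) (distribution P Z).
have m2E A : m2 A = (P (Z @^-1` A) * P E)%E.
  by rewrite /m2 /mscale /= fineK ?fin_num_measure// muleC.
rewrite -m2E -[LHS]/(m1 mZ S); apply: (measure_unique G (fun=> setT)) => //.
- exact: bigcup_const.
- by move=> A GA; rewrite -[RHS]/(m2 A) m2E -GE.
- move=> _; rewrite /= /pushforward /mrestr ltey_eq fin_num_measure ?orbT//.
  by rewrite preimage_setT setTI.
Qed.

Section rectangles.
Context d1 d2 (T1 : measurableType d1) (T2 : measurableType d2).

Definition rectangles : set (set (T1 * T2)) :=
  [set A `*` B | A in measurable & B in measurable].

Lemma rectanglesI : setI_closed rectangles.
Proof.
move=> _ _ [A1 mA1 [A2 mA2 <-]] [B1 mB1 [B2 mB2 <-]].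
exists (A1 `&` B1); first exact: measurableI.
exists (A2 `&` B2); first exact: measurableI.
by rewrite setXI.
Qed.

Lemma rectanglesT : rectangles setT.
Proof. by exists setT => //; exists setT => //; rewrite setXTT. Qed.

End rectangles.

Section frozen_walk.
Context d (T : measurableType d) (R : realType).
Context (P : probability T R) (X : nat -> {RV P >-> R}).

Definition frozen_step (u : R * R) : R := if 0 < u.1 then u.1 + u.2 else u.1.

(** The walk frozen once it is nonpositive; [frozen x n] is the position after the
step [X n], i.e. after [n + 1] steps. The first step is always made, so that the
start [x = 0] is covered. *)
Fixpoint frozen (x : R) (n : nat) : T -> R :=
  if n is m.+1 then fun w => frozen_step (frozen x m w, X m.+1 w)
  else fun w => x + X 0%N w.

Lemma measurable_frozen_step : measurable_fun setT frozen_step.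
Proof.
apply: measurable_fun_ifT.
- by apply: measurable_fun_ltr => //; exact: measurable_fst.
- by apply: measurable_funD; [exact: measurable_fst|exact: measurable_snd].
- exact: measurable_fst.
Qed.

Lemma measurable_frozen x n : measurable_fun setT (frozen x n).
Proof.
elim: n => [|n ih] /=; first exact: measurable_funD.
apply: (measurableT_comp measurable_frozen_step).
exact: measurable_fun_pair.
Qed.

HB.instance Definition _ x n :=
  isMeasurableFun.Build _ _ _ _ (frozen x n) (measurable_frozen x n).

Definition frozen_next x n w := (frozen x n w, X n.+1 w).

Lemma measurable_frozen_next x n : measurable_fun setT (frozen_next x n).
Proof. by apply: measurable_fun_pair => //; exact: measurable_frozen. Qed.

HB.instance Definition _ x n := isMeasurableFun.Build _ _ _ _
  (frozen_next x n) (measurable_frozen_next x n).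

Hypothesis X_indep : mutually_independent X.

Definition steps_event (J : {fset nat}) (B : nat -> set R) : set T :=
  \bigcap_(i in [set` J]) (X i @^-1` B i).

Lemma measurable_steps_event J B : (forall i, measurable (B i)) ->
  measurable (steps_event J B).
Proof.
move=> mB; apply: fin_bigcap_measurable; first exact: finite_fset.
by move=> i _; exact: measurable_preim.
Qed.

Definition override n (C : set R) (B : nat -> set R) i := if i == n then C else B i.

Lemma measurable_override n C B : measurable C -> (forall i, measurable (B i)) ->
  forall i, measurable (override n C B i).
Proof. by move=> mC mB i; rewrite /override; case: ifP. Qed.

Lemma steps_event_setU1 n J B C : n \notin J ->
  steps_event (n |` J)%fset (override n C B) = X n @^-1` C `&` steps_event J B.
Proof.
move=> nJ; rewrite /override; apply/seteqP; split => [w h|w [Cw h] i /=].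
- split; first by have := h n; rewrite /= eqxx; apply; rewrite !inE eqxx.
  move=> i /= iJ; have := h i; rewrite /= ifN; last by apply: contraNneq nJ => <-.
  by apply; rewrite !inE iJ orbT.
- rewrite !inE => /orP[/eqP ->|iJ]; first by rewrite eqxx.
  by rewrite ifN; [exact: h|apply: contraNneq nJ => <-].
Qed.

Lemma steps_indep n J B C : n \notin J -> (forall i, measurable (B i)) ->
  measurable C ->
  P (X n @^-1` C `&` steps_event J B) = (P (X n @^-1` C) * P (steps_event J B))%E.
Proof.
move=> nJ mB mC; rewrite -steps_event_setU1// /steps_event !X_indep//; last first.
  exact: measurable_override.
rewrite big_fsetU1//= /override eqxx; congr (_ * _)%E.
rewrite big_seq [RHS]big_seq; apply: eq_bigr => i iJ.
by rewrite ifN//; apply: contraNneq nJ => <-.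
Qed.

(** The frozen walk is independent of later steps. Keeping a whole family of later
steps in the statement makes the induction work: the next position is a function of
the pair of the current position and the next step, and this pair is independent of
the remaining steps because it is so on rectangles. *)
Lemma frozen_indep x n J B A : {in J, forall i, (n < i)%N} ->
  (forall i, measurable (B i)) -> measurable A ->
  P (frozen x n @^-1` A `&` steps_event J B) =
  (P (frozen x n @^-1` A) * P (steps_event J B))%E.
Proof.
elim: n => [|n ih] in J B A *.
  move=> J0 mB mA; rewrite [frozen x 0 @^-1` A](_ : _ = X 0%N @^-1` (+%R x @^-1` A))//.
  apply: steps_indep => //; first by apply/negP => /J0.
  by rewrite -[_ @^-1` _]setTI; apply: measurable_funD.
move=> Jn mB mA.
rewrite [frozen x n.+1 @^-1` A](_ : _ = frozen_next x n @^-1` (frozen_step @^-1` A))//.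
apply: (@indep_of_generator _ _ _ _ _ P (frozen_next x n) _ (@rectangles _ _ R R)).
- exact: measurable_steps_event.
- exact: measurable_prod_measurableType.
- exact: rectanglesI.
- exact: rectanglesT.
- move=> _ [C mC [D mD <-]].
  have nJ : n.+1 \notin J by apply/negP => /Jn; rewrite ltnn.
  rewrite [frozen_next x n @^-1` _](_ : _ = frozen x n @^-1` C `&` X n.+1 @^-1` D)//.
  rewrite -setIA -steps_event_setU1// ih//; last 2 first.
  + by move=> i; rewrite !inE => /orP[/eqP ->//|/Jn/ltnW].
  + exact: measurable_override.
  rewrite steps_event_setU1// steps_indep//.
  have := ih [fset n.+1]%fset (fun=> D) C.
  rewrite /steps_event set_fset1 bigcap_set1 => ->//; first by rewrite muleA.
  by move=> i; rewrite inE => /eqP ->.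
- by rewrite -[_ @^-1` _]setTI; exact: measurable_frozen_step.
Qed.

Lemma frozen_next_law x n S : measurable S ->
  (distribution P (frozen x n) \x distribution P (X n.+1))%E S =
  distribution P (frozen_next x n) S.
Proof.
apply: product_measure_unique => C D mC mD.
have := @frozen_indep x n [fset n.+1]%fset (fun=> D) C.
rewrite /steps_event set_fset1 bigcap_set1 => <-//.
by move=> i; rewrite inE => /eqP ->.
Qed.

Hypothesis X_id : identically_distributed X.

(** The supermartingale inequality for the frozen walk, by integrating the drift
condition over the law of the current position. *)
Lemma drift_frozen_step (g k : R -> R) x n :
  measurable_fun setT g -> measurable_fun setT k ->
  (forall y, 0 <= g y) -> (forall y, 0 <= k y) -> drift_below (X 0%N) g k ->
  (\int[P]_w (g (frozen x n.+1 w))%:E +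
     \int[P]_w (k (frozen x n w) * (0 < frozen x n w)%R%:R)%:E <=
   \int[P]_w (g (frozen x n w))%:E)%E.
Proof.
move=> mg mk g0 k0 drift.
have mgE : measurable_fun setT (EFin \o g) by exact/measurable_EFinP.
have mgk : measurable_fun setT (EFin \o (g \o frozen_step)).
  by apply/measurable_EFinP/measurableT_comp => //; exact: measurable_frozen_step.
have gk0 u : (0 <= (EFin \o (g \o frozen_step)) u)%E by rewrite lee_fin /=.
pose k' y : R := k y * (0 < y)%R%:R.
have k'0 y : 0 <= k' y by rewrite mulr_ge0.
have mk' : measurable_fun setT (EFin \o k').
  apply/measurable_EFinP/measurable_funM => //; apply: measurable_bool_nat.
  rewrite (_ : [set w | _] = `]0, +oo[%classic) //.
  by apply/seteqP; split => u /=; rewrite in_itv/= andbT.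
have -> : (\int[P]_w (g (frozen x n.+1 w))%:E =
    \int[distribution P (frozen x n)]_y
      \int[distribution P (X n.+1)]_z (g (frozen_step (y, z)))%:E)%E.
  transitivity (\int[distribution P (frozen_next x n)]_u (g (frozen_step u))%:E)%E.
    by rewrite ge0_integral_distribution// => u; rewrite lee_fin.
  rewrite -[RHS](fubini_tonelli1 (m1 := distribution P (frozen x n))
    (m2 := distribution P (X n.+1)) _ mgk gk0).
  by apply: eq_measure_integral => S mS _; apply/esym; exact: frozen_next_law.
have -> : (\int[P]_w (g (frozen x n w))%:E = \int[distribution P (frozen x n)]_y (g y)%:E)%E.
  by rewrite ge0_integral_distribution// => u; rewrite lee_fin.
have -> : (\int[P]_w (k (frozen x n w) * (0 < frozen x n w)%R%:R)%:E =
    \int[distribution P (frozen x n)]_y (k' y)%:E)%E.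
  by rewrite ge0_integral_distribution// => u; rewrite lee_fin.
have mF := @measurable_fun_fubini_tonelli_F _ _ _ _ _ (distribution P (X n.+1)) _ mgk gk0.
rewrite -ge0_integralD//; last 2 first.
- by move=> y _; apply: integral_ge0 => z _; rewrite lee_fin.
- by move=> y _; rewrite lee_fin.
apply: ge0_le_integral => //.
- by move=> y _; apply: adde_ge0; [apply: integral_ge0 => z _|]; rewrite lee_fin.
- by apply: emeasurable_funD => //; exact: mF.
move=> y _; rewrite /k' /frozen_step /=; case: ltP => y0; last first.
  by rewrite mulr0 adde0 integral_cst//= probability_setT mule1.
rewrite mulr1; apply: le_trans (drift y (ltW y0)); rewrite leeD2r//.
have mgy : measurable_fun setT (fun z => (g (y + z))%:E).
  by apply/measurable_EFinP/measurableT_comp => //; exact: measurable_funD.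
rewrite (eq_measure_integral (distribution P (X 0%N))); last first.
  by move=> A mA _; exact: X_id.
by rewrite ge0_integral_distribution// => u; rewrite lee_fin.
Qed.

Lemma drift_frozen_sum (g k : R -> R) x n : 0 <= x ->
  measurable_fun setT g -> measurable_fun setT k ->
  (forall y, 0 <= g y) -> (forall y, 0 <= k y) -> drift_below (X 0%N) g k ->
  (\int[P]_w (g (frozen x n w))%:E +
     \sum_(j < n) \int[P]_w (k (frozen x j w) * (0 < frozen x j w)%R%:R)%:E <=
   (g x)%:E)%E.
Proof.
move=> x0 mg mk g0 k0 drift; elim: n => [|n ih].
  rewrite big_ord0 adde0; apply: le_trans (drift x x0).
  by rewrite leeDl// lee_fin.
rewrite big_ord_recr/=; apply: le_trans ih.
rewrite addeCA addeC leeD2r//.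
exact: drift_frozen_step.
Qed.

Lemma drift_frozen (g k : R -> R) x n : 0 <= x ->
  measurable_fun setT g -> measurable_fun setT k ->
  (forall y, 0 <= g y) -> (forall y, 0 <= k y) -> drift_below (X 0%N) g k ->
  (\int[P]_w (g (frozen x n w))%:E <= (g x)%:E)%E.
Proof.
move=> x0 mg mk g0 k0 drift; apply: le_trans (drift_frozen_sum n x0 mg mk g0 k0 drift).
rewrite leeDl// sume_ge0// => j _; apply: integral_ge0 => w _.
by rewrite lee_fin mulr_ge0.
Qed.

End frozen_walk.

(** * The exit and the overshoot *)

Section exit.
Context d (T : measurableType d) (R : realType).
Context (P : probability T R) (X : nat -> {RV P >-> R}).

Lemma frozen_walk x k w :
  (forall j, (0 < j <= k)%N -> 0 < x + walk X j w) ->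
  frozen X x k w = x + walk X k.+1 w.
Proof.
elim: k => [|k ih] pos; first by rewrite /walk big_ord_recl big_ord0 addr0.
rewrite /= ih; last by move=> j /andP[j0 jk]; apply: pos; rewrite j0 leqW.
rewrite /frozen_step /= pos ?ltnSn// -addrA; congr (_ + _).
by rewrite /walk [RHS]big_ord_recr.
Qed.

Lemma frozen_absorbed x n m w : (n <= m)%N -> frozen X x n w <= 0 ->
  frozen X x m w = frozen X x n w.
Proof.
move=> /subnK <- n0; elim: (m - n)%N => [|k ih] //.
by rewrite addSn /= ih /frozen_step /= ltNge n0.
Qed.

Lemma exit_timeP x w :
  match exit_time X x w with
  | Some n => exists2 k, forall j, (j < k)%N -> 0 < frozen X x j w &
      frozen X x k w = x + walk_at_exit X x w /\ frozen X x k w <= 0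
  | None => forall k, 0 < frozen X x k w
  end.
Proof.
rewrite /walk_at_exit /exit_time; case: pselect => [ex|nex].
- case: ex_minnP => n /andP[n0 wn] nmin.
  have pos j : (0 < j < n)%N -> 0 < x + walk X j w.
    move=> /andP[j0 jn]; rewrite ltNge; apply/negP => wj.
    by have := nmin j; rewrite j0 wj => /(_ isT); rewrite leqNgt jn.
  exists n.-1.
  + move=> j jn; have jn' : (j.+1 < n)%N by rewrite -ltn_predRL.
    rewrite frozen_walk ?pos//= => i /andP[i0 ij]; apply: pos.
    by rewrite i0 (leq_ltn_trans ij)// (ltn_trans _ jn').
  + rewrite frozen_walk ?prednK// => j /andP[j0 jn]; apply: pos.
    by rewrite j0 -[ltnRHS]prednK.
- have pos j : (0 < j)%N -> 0 < x + walk X j w.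
    by move=> j0; rewrite ltNge; apply/negP => wj; apply: nex; exists j; rewrite j0.
  by move=> k; rewrite frozen_walk ?pos// => j /andP[j0 _]; exact: pos.
Qed.

Definition stopped_position x w := x + walk_at_exit X x w.
(** The default value [x] agrees with [stopped_position] on paths that never exit, where
[walk_at_exit] is [0], so that the convergence below holds everywhere. *)
Definition stopped_position_by x n w := if frozen X x n w <= 0 then frozen X x n w else x.

Lemma stopped_position_by_eventually x w :
  \forall n \near \oo, stopped_position_by x n w = stopped_position x w.
Proof.
have := exit_timeP x w; rewrite /stopped_position_by /stopped_position.
case E : (exit_time X x w) => [n|].
- move=> [k _ [<- k0]]; exists k => // m /= km.
  by rewrite (frozen_absorbed km k0) k0.
- move=> pos; exists 0%N => // m _ /=.
  by rewrite leNgt pos /= /walk_at_exit E addr0.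
Qed.

Lemma measurable_stopped_position_by x n : measurable_fun setT (stopped_position_by x n).
Proof.
have mk := measurable_frozen X x n.
by apply: measurable_fun_ifT => //; exact: measurable_fun_ler.
Qed.

Lemma measurable_stopped_position x : measurable_fun setT (stopped_position x).
Proof.
apply: (@measurable_fun_cvg _ _ _ _ (stopped_position_by x)) => [n|w _].
  exact: measurable_stopped_position_by.
exact: cvg_near_cst (stopped_position_by_eventually x w).
Qed.

Definition undershoot x w := pospart (- stopped_position x w).

Lemma measurable_undershoot x : measurable_fun setT (undershoot x).
Proof.
by apply: measurable_fun_pospart; apply: measurable_funN; exact: measurable_stopped_position.
Qed.

Definition never_exit x := [set w | forall n, 0 < frozen X x n w].

Lemma measurable_never_exit x : measurable (never_exit x).
Proof.
rewrite (_ : never_exit x = \bigcap_n (frozen X x n @^-1` `]0, +oo[%classic)).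
  apply: bigcapT_measurable => n; rewrite -[_ @^-1` _]setTI.
  exact: measurable_frozen.
apply/seteqP; split=> w /=.
  by move=> h n _ /=; rewrite in_itv/= andbT; exact: h.
by move=> h n; have := h n I; rewrite /= in_itv/= andbT.
Qed.

Lemma stopped_position_undershoot x w : ~ never_exit x w -> stopped_position x w = - undershoot x w.
Proof.
rewrite /undershoot /stopped_position; have := exit_timeP x w.
case: (exit_time X x w) => [n|] //.
move=> [k _ [<- k0]] _; case: pospartP => h; lra.
Qed.

Lemma stopped_position_le x w : 0 <= x -> `|stopped_position x w| <= undershoot x w + x.
Proof.
move=> x0; rewrite /undershoot /stopped_position; have := exit_timeP x w.
rewrite /walk_at_exit; case: (exit_time X x w) => [n|].
  move=> [k _ [<- k0]]; case: pospartP => h; rewrite ler0_norm//; lra.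
by move=> _; rewrite addr0 ger0_norm// lerDr pospart_ge0.
Qed.

Hypothesis X_indep : mutually_independent X.
Hypothesis X_id : identically_distributed X.

(** A Lyapunov function dominates the mean overshoot, by monotone convergence along
the frozen walk. *)
Lemma undershoot_le (g : R -> R) x : 0 <= x -> measurable_fun setT g ->
  (forall y : R, 0 <= g y) -> (forall y : R, y < 0 -> g y = - y) ->
  drift_below (X 0%N) g (fun=> 0) ->
  (\int[P]_w (undershoot x w)%:E <= (g x)%:E)%E.
Proof.
move=> x0 mg g0 gneg drift.
pose f n w := (pospart (- stopped_position_by x n w))%:E.
have fE w : \forall n \near \oo, f n w = (undershoot x w)%:E.
  by apply: filterS (stopped_position_by_eventually x w) => n; rewrite /f => ->.
have mf n : measurable_fun setT (f n).
  apply/measurable_EFinP/measurable_fun_pospart/measurable_funN.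
  exact: measurable_stopped_position_by.
have f0 n w : setT w -> (0 <= f n w)%E by rewrite lee_fin pospart_ge0.
have fnd w : setT w -> nondecreasing_seq (f^~ w).
  move=> _ n m nm; rewrite /f /stopped_position_by lee_fin.
  case: ifPn => [n0|_]; first by rewrite (frozen_absorbed nm n0) n0.
  by case: (pospartP (- x)) => h; rewrite ?pospart_ge0//; apply: le_trans (pospart_ge0 _); lra.
have := @cvg_monotone_convergence _ _ _ P _ measurableT _ mf f0 fnd.
under eq_integral do rewrite (lim_near_cst _ (fE _))//.
apply: cvge_le; near=> n.
apply: le_trans (@drift_frozen _ _ _ _ _ X_indep X_id g (fun=> 0) x n x0 mg _ g0 _ drift) => //.
apply: ge0_le_integral => //.
- exact: f0.
- by apply/measurable_EFinP/measurableT_comp => //; exact: measurable_frozen.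
- move=> w _; rewrite lee_fin /stopped_position_by; case: ifPn => h.
    case: pospartP => h' //; move: h; rewrite le_eqVlt => /orP[/eqP ->|/gneg -> //].
    by rewrite oppr0.
  by apply: le_trans (g0 _); case: (pospartP (- x)) => h' //; lra.
Unshelve. all: by end_near. Qed.

Hypothesis sqint : P.-integrable setT (EFin \o (fun w => X 0%N w ^+ 2)).
Hypothesis EX : Rintegral P setT (X 0%N) = 0.
Hypothesis VX : 0 < Rintegral P setT (fun w => X 0%N w ^+ 2).

(** As [X] is centred, adding the identity to a supersolution is harmless; when
[g y = - y] for [y < 0], the sum is still nonnegative, and it now dominates [y^+]. *)
Lemma drift_add_id (g : R -> R) : measurable_fun setT g -> (forall y, 0 <= g y) ->
  drift_below (X 0%N) g (fun=> 0) ->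
  drift_below (X 0%N) (fun y => y + g y) (fun=> 0).
Proof.
move=> mg g0 drift y y0; have := drift y y0; rewrite !adde0 => gy.
have iy : P.-integrable setT (EFin \o (fun w => y + X 0%N w)).
  by apply: integrable_add; [exact: integrable_cst|exact: integrable_step].
have ig : P.-integrable setT (EFin \o (fun w => g (y + X 0%N w))).
  apply/integrableP; split.
    by apply/measurable_EFinP/measurableT_comp => //; exact: measurable_funD.
  apply: le_lt_trans (ltry (g y)); apply: le_trans gy.
  by under eq_integral do rewrite /= ger0_norm//.
rewrite integralD_EFin// EFinD leeD//.
rewrite -(fineK (integrable_fin_num measurableT iy)) lee_fin.
change (Rintegral P setT (fun w => y + X 0%N w) <= y).
rewrite RintegralD//; [|exact: integrable_cst|exact: integrable_step].
by rewrite Rintegral_prob_cst EX addr0.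
Qed.

Lemma drift_weaken (g k : R -> R) : (forall y : R, 0 <= k y) ->
  drift_below (X 0%N) g k -> drift_below (X 0%N) g (fun=> 0).
Proof.
move=> k0 drift y y0; apply: le_trans (drift y y0).
by rewrite leeD2l// lee_fin.
Qed.

(** On [never_exit x] the position [y] either satisfies [0 < y <= L], or [V y / L >= 1];
the mean of [V y / L] is at most [V x / L] by the supermartingale property. *)
Lemma never_exit_step (V : R -> R) (delta L x : R) j :
  0 <= x -> 0 < delta -> 0 < L -> measurable_fun setT V ->
  (forall y : R, 0 <= V y) -> (forall y : R, y <= V y) ->
  drift_below (X 0%N) V (fun=> 0) ->
  ((delta * fine (P (never_exit x)))%:E <=
    \int[P]_w (delta * (frozen X x j w <= L)%R%:R * (0 < frozen X x j w)%R%:R)%:E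
      + (delta / L * V x)%:E)%E.
Proof.
move=> x0 d0 L0 mV V0 Vid drift.
have mY := measurable_frozen X x j; have mN := measurable_never_exit x.
have mYL : measurable_fun setT (fun w =>
    delta * (frozen X x j w <= L)%R%:R * (0 < frozen X x j w)%R%:R).
  have mset (B : set R) (p : R -> bool) : measurable B -> (forall y, B y <-> p y) ->
      measurable [set w | p (frozen X x j w)].
    move=> mB Bp; rewrite (_ : [set w | _] = frozen X x j @^-1` B).
      by rewrite -[_ @^-1` _]setTI; exact: mY.
    by apply/seteqP; split => w /= /Bp.
  apply: measurable_funM; first apply: measurable_funM => //.
  - apply/measurable_bool_nat/(mset `]-oo, L]%classic (fun y => y <= L)) => //.
  - apply/measurable_bool_nat/(mset `]0, +oo[%classic (fun y => 0 < y)) => // y.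
    by rewrite /= in_itv/= andbT.
have dL0 : 0 <= delta / L by rewrite divr_ge0 ?ltW.
have mVY : measurable_fun setT (fun w => V (frozen X x j w)) by exact: measurableT_comp.
apply: (@le_trans _ _ (\int[P]_w (delta * (frozen X x j w <= L)%R%:R * (0 < frozen X x j w)%R%:R)%:E
   + (delta / L)%:E * \int[P]_w (V (frozen X x j w))%:E)%E); last first.
  rewrite leeD2l// [leRHS]EFinM lee_wpmul2l ?lee_fin//.
  by apply: (drift_frozen X_indep X_id (k := fun=> 0)).
rewrite -ge0_integralZl_EFin//; last 2 first.
- by move=> w _; rewrite lee_fin.
- exact/measurable_EFinP.
rewrite -ge0_integralD//; last 4 first.
- by move=> w _; rewrite lee_fin !mulr_ge0// ltW.
- exact/measurable_EFinP.
- by move=> w _; rewrite -EFinM lee_fin mulr_ge0.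
- by apply/measurable_EFinP; exact: measurable_funM.
rewrite EFinM fineK ?fin_num_measure//.
rewrite -[X in (_ * P X)%E]setIT -integral_indic// -ge0_integralZl_EFin//; last 2 first.
- exact/measurable_EFinP/measurable_indic.
- exact: ltW.
apply: ge0_le_integral => //.
- by move=> w _; rewrite -EFinM lee_fin mulr_ge0// ltW.
- by apply/measurable_EFinP/measurable_funM => //; exact: measurable_indic.
- apply: emeasurable_funD; apply/measurable_EFinP => //; exact: measurable_funM.
move=> w _; rewrite -!EFinM -EFinD lee_fin indicE.
have VL : 0 <= delta / L * V (frozen X x j w) by rewrite mulr_ge0.
have [wN|wN] := boolP (w \in never_exit x); last first.
  by rewrite mulr0 addr_ge0// !mulr_ge0// ltW.
rewrite (set_mem wN j) !mulr1; have [YL|YL] := leP (frozen X x j w) L.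
  by rewrite mulr1 lerDl.
rewrite mulr0 add0r mulrAC -mulrA ler_peMr//; first exact: ltW.
by rewrite ler_pdivlMr// mul1r (le_trans (ltW YL)).
Qed.

(** The terms [a j] below, proportional to the probability of a position in the
interval [0 < y <= L] at time [j], have a bounded sum; averaging
[never_exit_step] over [j < n] and letting [n] grow leaves only the contribution
of positions above [L]. *)
Lemma never_exit_bound x : 0 <= x -> exists2 v : R, 0 <= v &
  forall L : R, 0 < L -> L * fine (P (never_exit x)) <= v.
Proof.
move=> x0.
have eps1 : 0 < (1 : R) <= 1 by rewrite ltr01/=.
have k0 (L : R) (dl : R) : 0 < dl -> forall y : R, 0 <= dl * (y <= L)%R%:R.
  by move=> dl0 y; rewrite mulr_ge0// ltW.
have mk (L dl : R) : measurable_fun setT (fun y : R => dl * (y <= L)%R%:R).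
  apply: measurable_funM => //; apply: measurable_bool_nat.
  have -> : [set y : R | y <= L] = `]-oo, L]%classic.
    by apply/seteqP; split => u /=; rewrite in_itv/=.
  exact: measurable_itv.
have [g [A [delta [[delta0 A0] mg [g0 gneg] _ drift]]]] :=
  lyapunov_exists sqint EX VX eps1 (lexx 0).
pose V (y : R) := y + g y.
have mV : measurable_fun setT V by exact: measurable_funD.
have V0 (y : R) : 0 <= V y.
  by rewrite /V; have := g0 y; case: (ltP y 0) => [/gneg ->|]; lra.
have Vid (y : R) : y <= V y by rewrite /V; have := g0 y; lra.
have Vdrift : drift_below (X 0%N) V (fun=> 0).
  by apply: drift_add_id => //; apply: drift_weaken drift; exact: k0.
exists (V x) => // L L0.
have [h [B [dl [[dl0 _] mh [h0 _] _ hdrift]]]] :=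
  lyapunov_exists sqint EX VX eps1 (ltW L0).
set q := fine _; pose c := dl / L * V x.
pose a j := (\int[P]_w (dl * (frozen X x j w <= L)%R%:R * (0 < frozen X x j w)%R%:R)%:E)%E.
have sum_a n : (\sum_(j < n) a j <= (h x)%:E)%E.
  apply: le_trans (drift_frozen_sum X_indep X_id n x0 mh (mk L dl) h0 (k0 L dl dl0) hdrift).
  by rewrite leeDr// integral_ge0// => w _; rewrite lee_fin.
have n_q n : ((n%:R * (dl * q))%:E <= \sum_(j < n) a j + (n%:R * c)%:E)%E.
  elim: n => [|n ih]; first by rewrite big_ord0 !mul0r adde0.
  rewrite big_ord_recr/= -natr1 !mulrDl !mul1r !EFinD addeACA leeD//.
  exact: never_exit_step.
have {}n_q n : n%:R * (dl * q - c) <= h x.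
  rewrite mulrBr lerBlDr -lee_fin EFinD (le_trans (n_q n))//.
  by rewrite leeD2r.
have : dl * q <= c.
  rewrite leNgt; apply/negP => cq.
  have e0 : 0 < dl * q - c by rewrite subr_gt0.
  have := n_q (Num.truncn (h x / (dl * q - c))).+1.
  by rewrite leNgt -ltr_pdivrMr// truncnS_gt.
by rewrite /c -mulrA ler_pM2l// mulrC ler_pdivlMr// mulrC.
Qed.

Lemma never_exit_null x : 0 <= x -> P (never_exit x) = 0%E.
Proof.
move=> x0; have [v v0 hv] := never_exit_bound x0.
have Nfin : (P (never_exit x) \is a fin_num).
  by apply: fin_num_measure; exact: measurable_never_exit.
rewrite -(fineK Nfin); congr EFin.
have q0 : 0 <= fine (P (never_exit x)) by exact: fine_ge0.
apply/eqP; rewrite eq_le q0 andbT leNgt; apply/negP => qpos.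
set q := fine _ in hv qpos.
have := hv (v / q + 1); rewrite mulrDl divfK ?gt_eqF// mul1r.
have : 0 < v / q + 1 by rewrite ltr_wpDl// divr_ge0// ltW.
by move=> -> /(_ isT); lra.
Qed.

Lemma overshoot_undershoot x : 0 <= x ->
  P.-integrable setT (EFin \o undershoot x) ->
  P.-integrable setT (EFin \o stopped_position x) /\
  overshoot X x = (\int[P]_w (undershoot x w)%:E)%E.
Proof.
move=> x0 iu; have mD := measurable_stopped_position x.
split.
  apply: (le_integrable measurableT _ _ (integrable_add iu (integrable_cst P x))).
    exact/measurable_EFinP.
  by move=> w _; rewrite /= lee_fin (le_trans (stopped_position_le w x0))// ler_norm.
rewrite /overshoot unlock.
have -> : (\int[P]_w (x + walk_at_exit X x w)%:E = \int[P]_w ((-1)%:E * (undershoot x w)%:E))%E.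
  apply: ae_eq_integral => //.
  - exact/measurable_EFinP.
  - by apply/measurable_EFinP/measurable_funM => //; exact: measurable_undershoot.
  exists (never_exit x); split; [exact: measurable_never_exit|exact: never_exit_null|].
  move=> w /= h; apply: contrapT => nw; apply: h => _.
  by rewrite -EFinM mulN1r -stopped_position_undershoot.
by rewrite integralZl// EFinN mulN1e oppeK.
Qed.

Lemma overshoot_le (eps : R) : 0 < eps <= 1 -> exists2 A : R, 0 <= A &
  forall x, 0 <= x -> P.-integrable setT (EFin \o stopped_position x) /\
    (0 <= overshoot X x <= (A + eps * x)%:E)%E.
Proof.
move=> eps01.
have [g [A [delta [[delta0 A0] mg [g0 gneg] glin drift]]]] :=
  lyapunov_exists sqint EX VX eps01 (lexx 0).
exists A => // x x0.
have drift0 : drift_below (X 0%N) g (fun=> 0).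
  by apply: drift_weaken drift => y; rewrite mulr_ge0// ltW.
have ug := undershoot_le x0 mg g0 gneg drift0.
have u0 w : 0 <= undershoot x w by exact: pospart_ge0.
have iu : P.-integrable setT (EFin \o undershoot x).
  apply/integrableP; split; first by apply/measurable_EFinP; exact: measurable_undershoot.
  under eq_integral do rewrite /= ger0_norm//.
  exact: le_lt_trans ug (ltry _).
have [iD ->] := overshoot_undershoot x0 iu; split => //.
apply/andP; split; first by apply: integral_ge0 => w _; rewrite lee_fin.
by apply: (le_trans ug); rewrite lee_fin glin.
Qed.

End exit.

(** * Finiteness and sublinear growth of the mean overshoot *)

Theorem proposition6p1 (d : measure_display) (T : measurableType d)
    (R : realType) (P : probability T R) (X : nat -> {RV P >-> R}) (sigma : R)
    (X_indep : mutually_independent X)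
    (X_id : identically_distributed X)
    (sigma_gt0 : 0 < sigma)
    (EX : ('E_P[X 0%N] = 0)%E)
    (EX2 : ('E_P[fun w => (X 0%N w ^+ 2)%R] = (sigma ^+ 2)%:E)%E) :
  [/\ forall x : R, 0 <= x -> overshoot X x \is a fin_num,
      forall x : R, 0 <= x -> renewal X x = (x%:E + overshoot X x)%E
    & (fun x : R => fine (overshoot X x)) =o_ (+oo_R) (fun x : R => x)].
Proof.
have EX_real : Rintegral P setT (X 0%N) = 0.
  by move: EX; rewrite unlock /Rintegral => ->.
have EX2_real : Rintegral P setT (fun w => X 0%N w ^+ 2) = sigma ^+ 2.
  by move: EX2; rewrite unlock /Rintegral => ->.
have sqint : P.-integrable setT (EFin \o (fun w => X 0%N w ^+ 2)).
  apply/integrableP; split; first by apply/measurable_EFinP/measurable_funX.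
  under eq_integral do rewrite /= ger0_norm ?sqr_ge0//.
  by move: EX2; rewrite unlock => ->; exact: ltry.
have VX : 0 < Rintegral P setT (fun w => X 0%N w ^+ 2).
  by rewrite EX2_real exprn_gt0.
have bound := overshoot_le X_indep X_id sqint EX_real VX.
have one1 : 0 < (1 : R) <= 1 by rewrite ltr01/=.
have fin x : 0 <= x -> overshoot X x \is a fin_num.
  move=> x0; have [A _ /(_ x x0)] := bound 1 one1.
  move=> [_ /andP[h0 hxA]].
  by rewrite ge0_fin_numE// (le_lt_trans hxA) ?ltry.
split.
- exact: fin.
- move=> x x0; have [A _ /(_ x x0)] := bound 1 one1.
  move=> [iD _].
  have ix := integrable_cst P x.
  rewrite /renewal /overshoot unlock.
  transitivity (\int[P]_w (x%:E - (stopped_position X x w)%:E))%E.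
    by apply: eq_integral => w _; rewrite -EFinB /stopped_position opprD addrA subrr add0r.
  by rewrite (integralB measurableT ix iD)// integral_cst//= probability_setT mule1.
- apply/eqoP => eps eps0.
  (* Half of eps is kept to absorb the constant A. *)
  pose e := Num.min (eps / 2) 1.
  have e01 : 0 < e <= 1 by rewrite /e lt_min divr_gt0// ltr01 ge_min lexx orbT.
  have [A A0 hA] := bound e e01.
  have ee : e <= eps / 2 by rewrite /e ge_min lexx.
  near=> x.
  have x0 : 0 <= x by near: x; apply: nbhs_pinfty_ge; exact: num_real.
  have xA : A / (eps / 2) <= x by near: x; apply: nbhs_pinfty_ge; exact: num_real.
  have [_ /andP[h0 hxA]] := hA x x0.
  rewrite !ger0_norm ?fine_ge0//.
  rewrite -lee_fin fineK ?fin// (le_trans hxA)// lee_fin.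
  rewrite ler_pdivrMr ?divr_gt0// in xA.
  have : e * x <= eps / 2 * x by rewrite ler_wpM2r.
  lra.
Unshelve. all: by end_near. Qed.
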